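(* Let $G$ be a finite simple connected graph on $n\ge 3$ vertices. Any two network realignments in $R_G$ lie in the same connected component of $R_G$ if and only if they have the same spine and the same spine assignment.
   Context: A network realignment $N=(T,r)$ over $G$ consists of a partition $V(G)=A\sqcup B$ with $|A|\ge 2$ ($B$ may be empty), a tree $T$ that is a subgraph of $G$ with vertex set $A$, and a map $r\colon B\to E(T)$ such that $(b,v),(b,w)\in E(G)$ whenever $b\in B$ and $r(b)=(v,w)$. For $b\in B$ and an endpoint $v$ of $r(b)$, the specification $N^{b\to v}$ is the network realignment with partition $A\cup\{b\}$, $B\setminus\{b\}$, tree obtained from $T$ by adding the vertex $b$ and the edge $(v,b)$, and map $r|_{B\setminus\{b\}}$. $X_G$ is the finite cubical complex whose face poset is the set of all network realignments over $G$ with partial order generated by $N\succ N^{b\to v}$; the cell indexed by $N$ is a cube of dimension $|B|$. The spine $\operatorname{Sp}(N)$ is the subtree of $T$ consisting of the interior vertices $\operatorname{Int}(T)$ (vertices of degree $\ge2$ in $T$) and the edges in $\operatorname{Im}(r)$ (with their endpoints); $|\operatorname{Sp}(N)|$ is its number of edges. For a leaf $v$ of a tree $S$, $p_S(v)$ denotes its unique neighbour. A vertex $v$ is a barrier of $w$ if $(v,w)\notin E(G)$. A leaf $u$ of $\operatorname{Sp}(N)$ is occupied if there is a vertex $v\in V(T)\setminus V(\operatorname{Sp}(N))$ with $p_T(v)=u$ such that $p_{\operatorname{Sp}(N)}(u)$ is a barrier of $v$. The spine is minimal if $|\operatorname{Sp}(N)|\le 1$ or all leaves of $\operatorname{Sp}(N)$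 are occupied. $Y_G\subseteq X_G$ is the subcomplex of all $N$ with minimal spine, $M_G\subseteq Y_G$ is the subcomplex of those $N\in Y_G$ whose spine has at most one occupied vertex, and $R_G=Y_G\setminus M_G$ is its complement (a union of connected components of $Y_G$). The spine assignment $c_N$ of $N$ assigns to every $v\in Z_N=V(G)\setminus V(\operatorname{Sp}(N))$ a connected component $c_N(v)$ of $\operatorname{Sp}(N)\setminus\{w\in \operatorname{Sp}(N)\mid w\text{ is a barrier of }v\}$: if $v\in B$, then $c_N(v)$ is the component containing $r(v)$; if $v\in A$, then $c_N(v)$ is the component containing $p_T(v)$. *)

(* Defs.v *)
From HB Require Import structures.
From mathcomp Require Import all_boot.

Set Implicit Arguments.
Unset Strict Implicit.
Unset Printing Implicit Defensive.

(* The simple graph G is a relation [e] on a finType [V]; it is assumed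
   symmetric, irreflexive and connected in the theorem. An (undirected) edge is
   the two-element set of its endpoints, and a set of edges [F] is a graph. *)

Definition edges (V : finType) (e : rel V) : {set {set V}} :=
  [set [set p.1; p.2] | p : V * V & e p.1 p.2].

Definition adj (V : finType) (F : {set {set V}}) : rel V :=
  [rel x y | [set x; y] \in F].

Definition deg (V : finType) (F : {set {set V}}) (v : V) : nat :=
  #|[set f in F | v \in f]|.

Definition leaf (V : finType) (F : {set {set V}}) (v : V) : bool :=
  deg F v == 1.

(* p_F(v); only meaningful when v is a leaf of F. *)
Definition leaf_nbr (V : finType) (F : {set {set V}}) (v : V) : V :=
  odflt v [pick w | adj F v w].

(* The length bound loses nothing: a cycle has no repeated vertex. *)
Definition acyclic (V : finType) (F : {set {set V}}) : bool :=
  [forall n : 'I_#|V|.+1, [forall s : n.-tuple V,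
     ~~ [&& 2 < n, uniq s & cycle (adj F) s]]].

Definition subtree (V : finType) (e : rel V)
    (A : {set V}) (F : {set {set V}}) : bool :=
  [&& F \subset edges e, [forall f in F, f \subset A],
      [forall x in A, [forall y in A, connect (adj F) x y]] & acyclic F].

(* Raw data (A, E(T), r); the set B is the complement of A, and r is extended
   to V(G) by [None] on A. *)
Definition pre_realignment (V : finType) : Type :=
  ({set V} * {set {set V}} * {ffun V -> option {set V}})%type.


Definition is_realignment (V : finType) (e : rel V) (N : pre_realignment V) :
    bool :=
  let: (A, F, r) := N in
  [&& 2 <= #|A|, subtree e A F &
      [forall b, if r b is Some f
                 then [&& b \notin A, f \in F & [forall v in f, e b v]]
                 else b \in A]].

Record realignment (V : finType) (e : rel V) := Realignment {
  realign_val :> pre_realignment V;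
  _ : is_realignment e realign_val }.

HB.instance Definition _ (V : finType) (e : rel V) :=
  [isSub for @realign_val V e].
HB.instance Definition _ (V : finType) (e : rel V) :=
  [Countable of realignment e by <:].
HB.instance Definition _ (V : finType) (e : rel V) :=
  [Finite of realignment e by <:].

Definition vertA (V : finType) (N : pre_realignment V) : {set V} := N.1.1.
Definition treeE (V : finType) (N : pre_realignment V) : {set {set V}} := N.1.2.
Definition rmap (V : finType) (N : pre_realignment V) :
  {ffun V -> option {set V}} := N.2.

(* N^{b -> v} *)
Definition specify (V : finType) (N : pre_realignment V) (b v : V) :
    pre_realignment V :=
  (b |: vertA N, [set v; b] |: treeE N,
   [ffun x => if x == b then None else rmap N x]).

Definition gen_succ (V : finType) (e : rel V) : rel (realignment e) :=
  [rel N N' : realignment e | [exists b, [exists v,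
     (if rmap N b is Some f then v \in f else false)
     && (realign_val N' == specify N b v)]]].

(* The partial order of the face poset of X_G: N' is a face of N. *)
Definition face (V : finType) (e : rel V) (N' N : realignment e) : bool :=
  connect (@gen_succ V e) N N'.

Definition interior (V : finType) (N : pre_realignment V) : {set V} :=
  [set v | 2 <= deg (treeE N) v].

Definition im_r (V : finType) (N : pre_realignment V) : {set {set V}} :=
  [set f | [exists b, rmap N b == Some f]].

Definition spineV (V : finType) (N : pre_realignment V) : {set V} :=
  interior N :|: cover (im_r N).

(* As a subtree of T, the spine contains the edges of T between interior
   vertices. *)
Definition spineE (V : finType) (N : pre_realignment V) : {set {set V}} :=
  [set f in treeE N | f \subset interior N] :|: im_r N.

Definition barrier (V : finType) (e : rel V) (v w : V) : bool := ~~ e v w.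

Definition occupied (V : finType) (e : rel V) (N : pre_realignment V) (u : V) :
    bool :=
  leaf (spineE N) u &&
  [exists v in vertA N :\: spineV N,
     (leaf_nbr (treeE N) v == u) && barrier e (leaf_nbr (spineE N) u) v].

Definition minimal_spine (V : finType) (e : rel V) (N : pre_realignment V) :
    bool :=
  (#|spineE N| <= 1) || [forall u, leaf (spineE N) u ==> occupied e N u].

Definition Y_ (V : finType) (e : rel V) : {set realignment e} :=
  [set N : realignment e | minimal_spine e N].

Definition M_ (V : finType) (e : rel V) : {set realignment e} :=
  [set N in Y_ e | #|[set u | occupied e N u]| <= 1].

Definition R_ (V : finType) (e : rel V) : {set realignment e} :=
  Y_ e :\: M_ e.

(* Two cells lie in the same connected component of the set of cells [S] when
   they are joined by a chain of cells of S in which consecutive cells are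
   faces of one another. *)
Definition same_component (V : finType) (e : rel V)
    (S : {set realignment e}) : rel (realignment e) :=
  connect [rel N N' : realignment e | [&& N \in S, N' \in S & face N N' || face N' N]].

(* Vertex sets of the connected components of the spine minus the barriers
   of v; the spine itself being a graph, they determine the components. *)
Definition spine_components (V : finType) (e : rel V)
    (N : pre_realignment V) (v : V) : {set {set V}} :=
  let D := spineV N :\: [set w | barrier e w v] in
  equivalence_partition
    (connect [rel x y | [&& x \in D, y \in D & adj (spineE N) x y]]) D.

Definition anchor (V : finType) (N : pre_realignment V) (v : V) : {set V} :=
  if rmap N v is Some f then f else [set leaf_nbr (treeE N) v].

Definition Z_ (V : finType) (N : pre_realignment V) : {set V} := ~: spineV N.

(* c_N(v), to be used for v in Z_N only. *)
Definition spine_assignment (V : finType) (e : rel V)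
    (N : pre_realignment V) (v : V) : {set V} :=
  odflt set0 [pick C in spine_components e N v | anchor N v \subset C].

Definition same_spine (V : finType) (N N' : pre_realignment V) : Prop :=
  spineV N = spineV N' /\ spineE N = spineE N'.

Definition same_assignment (V : finType) (e : rel V)
    (N N' : pre_realignment V) : Prop :=
  Z_ N = Z_ N' /\ {in Z_ N, spine_assignment e N =1 spine_assignment e N'}.

(* Main.v *)
Require Import Defs.
From mathcomp Require Import all_boot.

(** In a cell [N] of [R_ e] every leaf [u] of the spine is occupied: some
    vertex [v] of the tree off the spine hangs at [u], and the spine neighbour of
    [u] is a barrier of [v]. This forces the spine to be exactly the interior of
    the tree ([spineV_interior]), so [N] is the same thing as its spine
    [(S, F)] together with a function [q] sending each vertex off the spine to
    the spine vertex at which it hangs, or to the spine edge to which [r] maps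
    it. Lemma [assemble_anchor] recovers [N] from these data; conversely,
    [assemble_in_R] makes a cell of [R_ e] with the prescribed spine and places
    out of any data in which each leaf of the spine has its guard, a vertex such
    as [v] above.

    In these terms, specifying [b] to [v] replaces the edge [q b] by its
    endpoint [v] and changes nothing else. The edge and its endpoints contain no
    barrier of [b], hence the spine and the assignment do not change and the new
    data again define a cell of [R_ e] ([gen_succ_R]). This gives one
    implication.

    For the converse, the cells with a given spine and a given assignment form a
    product, over the vertices [v] off the spine, of the subtrees assigned to
    [v]. The occupation condition does not cut anything out of this product:
    the component assigned to a guard of the leaf [u] is [{u}], because the only
    edge at [u] leads to a barrier, so that guards never move
    ([guard_fixed], [settled_close]). A product of connected graphs is
    connected: the vertices are moved one after another ([linked_close]), each
    along a path of its component, and passing from a spine vertex [x] to an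
    adjacent [z] goes through the cell in which the vertex occupies the edge
    [[set x; z]], of which both positions are faces ([linked_reach]). *)

Set Implicit Arguments.
Unset Strict Implicit.
Unset Printing Implicit Defensive.

(** * Degrees, leaves and cycles of edge sets *)

Section Graphs.

Variables (V : finType) (e : rel V).
Hypotheses (e_sym : symmetric e) (e_irr : irreflexive e).
Implicit Types (F : {set {set V}}) (f : {set V}) (v w x y : V).

Lemma adjE F x y : adj F x y = ([set x; y] \in F).
Proof. by []. Qed.

Lemma adj_sym F : symmetric (adj F).
Proof. by move=> x y; rewrite /adj /= setUC. Qed.

Lemma set2_injr v x y : [set v; x] = [set v; y] -> x = y.
Proof.
move=> eq_xy.
have: x \in [set v; y] by rewrite -eq_xy set22.
have: y \in [set v; x] by rewrite eq_xy set22.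
rewrite !inE => /orP[/eqP-> | /eqP //] /orP[] /eqP //.
Qed.

Lemma adj_edge F x y : F \subset edges e -> adj F x y -> e x y.
Proof.
move=> /subsetP Fe /= /Fe /imsetP[[a b] /=]; rewrite inE /= => eab eq_f.
have xab : x \in [set a; b] by rewrite -eq_f set21.
have yab : y \in [set a; b] by rewrite -eq_f set22.
have axy : a \in [set x; y] by rewrite eq_f set21.
have bxy : b \in [set x; y] by rewrite eq_f set22.
have neq_ab : a != b by apply: contraTneq eab => ->; rewrite e_irr.
move: xab yab axy bxy; rewrite !inE.
case/orP=> /eqP eqx /orP[] /eqP eqy; subst x y; rewrite ?orbb => //.
- by rewrite [b == a]eq_sym (negPf neq_ab).
- by rewrite e_sym.
- by rewrite (negPf neq_ab).
Qed.

Lemma edge_at F f v : F \subset edges e -> f \in F -> v \in f ->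
  exists2 w, f = [set v; w] & e v w.
Proof.
move=> Fe Ff; have /imsetP[[a b] /=] := subsetP Fe _ Ff.
rewrite inE /= => eab ->; rewrite !inE => /orP[] /eqP->; first by exists b.
by exists a; [rewrite setUC | rewrite e_sym].
Qed.

Lemma edge_neq_set1 F f x : F \subset edges e -> f \in F -> f != [set x].
Proof.
move=> Fe Ff; apply: contraTneq isT => eq_f.
have [y eq_f' exy]: exists2 y, f = [set x; y] & e x y.
  by apply: edge_at Ff _; rewrite // eq_f set11.
have : y \in f by rewrite eq_f' set22.
by rewrite eq_f inE => /eqP eq_yx; rewrite eq_yx e_irr in exy.
Qed.

Lemma deg_gt0P F v : F \subset edges e ->
  reflect (exists w, adj F v w) (0 < deg F v).
Proof.
move=> Fe; apply: (iffP card_gt0P) => [[f] | [w adjvw]].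
  by rewrite inE => /andP[Ff fv]; have [w eqf _] := edge_at Fe Ff fv;
     exists w; rewrite adjE -eqf.
by exists [set v; w]; rewrite inE set21 andbT.
Qed.

Lemma deg_gt1P F v : F \subset edges e ->
  reflect (exists x y, [/\ x != y, adj F v x & adj F v y]) (1 < deg F v).
Proof.
move=> Fe; apply: (iffP card_gt1P) => [[f [g []]] | [x [y [neq_xy vx vy]]]].
  rewrite !inE => /andP[Ff fv] /andP[Fg gv].
  have [x eqf _] := edge_at Fe Ff fv; have [y eqg _] := edge_at Fe Fg gv.
  move=> neq_fg; exists x, y; rewrite !adjE -eqf -eqg; split=> //.
  by apply: contraNneq neq_fg => eqxy; rewrite eqf eqg eqxy.
exists [set v; x], [set v; y]; rewrite !inE !eqxx !andbT; split=> //.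
by apply: contraNneq neq_xy => /set2_injr->.
Qed.

Lemma leaf_nbr_eq F v w : (forall y, adj F v y = (y == w)) -> leaf_nbr F v = w.
Proof.
move=> nbr_v; rewrite /leaf_nbr; case: pickP => [y | /(_ w)].
  by rewrite nbr_v => /eqP.
by rewrite nbr_v eqxx.
Qed.

Lemma adj_leaf F v w : F \subset edges e -> leaf F v ->
  adj F v w = (w == leaf_nbr F v).
Proof.
move=> Fe leaf_v.
have /(deg_gt0P _ Fe)[x vx]: 0 < deg F v by rewrite (eqP leaf_v).
have nbr_v y : adj F v y = (y == x).
  apply/idP/eqP => [vy | -> //]; apply: contraTeq leaf_v => neq_yx.
  rewrite /leaf neq_ltn orbC; suff -> : 1 < deg F v by [].
  by apply/(deg_gt1P _ Fe); exists y, x.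
by rewrite (leaf_nbr_eq nbr_v).
Qed.

Lemma leaf_of_le1 F v : F \subset edges e -> deg F v <= 1 ->
  (exists w, adj F v w) -> leaf F v.
Proof. by move=> Fe le1 /(deg_gt0P _ Fe) gt0; rewrite /leaf eqn_leq le1. Qed.

Lemma deg_sub F F' v : F \subset F' -> deg F v <= deg F' v.
Proof.
move=> sFF'; apply/subset_leq_card/subsetP => f; rewrite !inE.
by case/andP=> /(subsetP sFF')-> ->.
Qed.

Lemma acyclicP F :
  reflect (forall s, 2 < size s -> uniq s -> ~~ cycle (adj F) s) (acyclic F).
Proof.
apply: (iffP forallP) => [acF s s3 us | acF n].
  have s_lt : size s < #|V|.+1 by rewrite ltnS -(card_uniqP us) max_card.
  have /forallP/(_ (in_tuple s)) := acF (Ordinal s_lt).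
  by rewrite /= s3 us.
apply/forallP => s; apply/negP => /and3P[n3 us].
by apply/negP; apply: acF; rewrite ?size_tuple.
Qed.

Lemma acyclic_sub F F' : F \subset F' -> acyclic F' -> acyclic F.
Proof.
move=> sFF' /acyclicP acF'; apply/acyclicP => s s3 us.
apply: contra (acF' s s3 us); apply: sub_cycle => x y.
exact: (subsetP sFF').
Qed.

(** The two neighbours of [x] along the cycle differ, as the cycle has at least
    three vertices. Hence a cycle avoids the leaves of a tree. *)
Lemma cycle_deg F s x : F \subset edges e -> 2 < size s -> uniq s ->
  cycle (adj F) s -> x \in s -> 1 < deg F x.
Proof.
move=> Fe s3 us cyc /rot_to[i t eq_t].
move: s3 us cyc; rewrite -(size_rot i) -(rot_uniq i) -(rot_cycle i) eq_t.
case: t {eq_t} => [|y t] //=; case/lastP: t => [|t z] //= _.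
rewrite rcons_path last_rcons mem_rcons inE negb_or.
case/andP=> _ /andP[/andP[neq_yz _] _] /and3P[xy _ zx].
by apply/(deg_gt1P _ Fe); exists y, z; rewrite adj_sym in zx.
Qed.

Lemma subtreeP (A : {set V}) F :
  reflect [/\ F \subset edges e, forall f, f \in F -> f \subset A,
    {in A &, forall x y, connect (adj F) x y} & acyclic F]
  (subtree e A F).
Proof.
apply: (iffP and4P) => [[Fe /forall_inP FA /forall_inP cA ac] | [Fe FA cA ac]].
  by split=> // x y Ax Ay; have /forall_inP/(_ y Ay) := cA x Ax.
split=> //; first by apply/forall_inP.
by apply/forall_inP => x Ax; apply/forall_inP => y Ay; apply: cA.
Qed.

Lemma subtree_adj_in (A : {set V}) F x y :
  subtree e A F -> adj F x y -> (x \in A) && (y \in A).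
Proof.
case/subtreeP=> _ FA _ _ /= /FA /subsetP sA.
by rewrite !sA ?set21 ?set22.
Qed.

Lemma subtree_deg_gt0 (A : {set V}) F x :
  subtree e A F -> 1 < #|A| -> x \in A -> 0 < deg F x.
Proof.
move=> tF A2 Ax; have [Fe _ cA _] := subtreeP _ _ tF.
have [y [Ay neq_yx]]: exists y, y \in A /\ y != x.
  have /card_gt1P[a [b [Aa Ab neq_ab]]] := A2.
  have [eq_ax | ] := eqVneq a x; last by exists a.
  by exists b; rewrite -eq_ax eq_sym.
have /connectP[[|z p] /=] := cA x y Ax Ay.
  by move=> _ eq_yx; rewrite eq_yx eqxx in neq_yx.
by case/andP=> xz _ _; apply/(deg_gt0P _ Fe); exists z.
Qed.

(** Two adjacent vertices of degree one would form a whole component. *)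
Lemma leaf_adj_interior (A : {set V}) F x v w : subtree e A F ->
  1 < deg F x -> adj F v w -> deg F v <= 1 -> 1 < deg F w.
Proof.
move=> tF x2 vw v1; have [Fe _ cA _] := subtreeP _ _ tF.
case: (ltnP 1 (deg F w)) => // w1.
have /andP[Av Aw] := subtree_adj_in tF vw.
have [y [_ [_ xy _]]] := deg_gt1P x Fe x2.
have /andP[Ax _] := subtree_adj_in tF xy.
have leaf_v : leaf F v by apply: leaf_of_le1; last by exists w.
have leaf_w : leaf F w.
  by apply: leaf_of_le1; last by exists v; rewrite adj_sym.
have cl : closed (adj F) [pred z | (z == v) || (z == w)].
  apply: (intro_closed (sym_connect_sym (adj_sym F))) => a b.
  move=> ab /orP[] /eqP eqa; move: ab; rewrite eqa.
    rewrite !(@adj_leaf F v _ Fe leaf_v) => /eqP->; move: vw.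
    by rewrite (@adj_leaf F v _ Fe leaf_v) => /eqP->; rewrite inE eqxx orbT.
  have wv : adj F w v by rewrite adj_sym.
  rewrite (@adj_leaf F w _ Fe leaf_w) => /eqP->; move: wv.
  by rewrite (@adj_leaf F w _ Fe leaf_w) => /eqP->; rewrite inE eqxx.
have := closed_connect cl (cA _ _ Av Ax); rewrite !inE eqxx /= => /esym.
by case/orP=> /eqP eqx; move: x2; rewrite eqx ltnNge ?v1 ?w1.
Qed.

End Graphs.

(** * Realignments assembled from a spine and the places of the other vertices *)

Section Assembly.

Variables (V : finType) (e : rel V).
Hypotheses (e_sym : symmetric e) (e_irr : irreflexive e).
Implicit Types (S p : {set V}) (F : {set {set V}}) (q : V -> {set V}).
Implicit Types (u v w x y : V).

(** A spine vertex [x] is encoded as [[set x]] and a spine edge as itself, so that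
    one set-valued function describes both the hanging vertices and [r]. *)
Definition placement S F v p : bool :=
  ((p \in F) || [exists x in S, p == [set x]]) && [forall w in p, e v w].

Definition unspecified S F q : {set V} := [set v | (v \notin S) && (q v \in F)].

(** A vertex [v] placed at the spine vertex [x] hangs by the edge
    [v |: [set x]], which is [v |: q v]. *)
Definition assemble S F q : pre_realignment V :=
  (~: unspecified S F q,
   F :|: [set v |: q v | v in ~: (S :|: unspecified S F q)],
   [ffun v => if v \in unspecified S F q then Some (q v) else None]).

(** This is occupation of [u], expressed without the tree. *)
Definition guarded S F q u : bool :=
  leaf F u && [exists v, [&& v \notin S, q v == [set u] & ~~ e (leaf_nbr F u) v]].

(** The data [(S, F, q)] of the cells of [R_ e]: the number of occupied leaves is
    the number of leaves, since all leaves are guarded. *)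
Definition settled S F q : Prop :=
  [/\ subtree e S F, 1 < #|[set u | leaf F u]|,
      forall u, leaf F u -> guarded S F q u &
      forall v, v \notin S -> placement S F v (q v)].

Lemma eq_assemble S F q q' :
  {in ~: S, q =1 q'} -> assemble S F q = assemble S F q'.
Proof.
move=> eq_q; have eqB : unspecified S F q = unspecified S F q'.
  apply/setP => v; rewrite !inE; case: (boolP (v \in S)) => //= vS.
  by rewrite eq_q ?inE.
rewrite /assemble -eqB; congr (_, _, _).
  congr (_ :|: _); apply: eq_in_imset => v.
  by rewrite !inE negb_or => /andP[vS _]; rewrite eq_q ?inE.
apply/ffunP => v; rewrite !ffunE; case: ifP => //.
by rewrite inE => /andP[vS _]; rewrite eq_q ?inE.
Qed.

Section Settled.

Variables (S : {set V}) (F : {set {set V}}) (q : V -> {set V}).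
Hypothesis set_q : settled S F q.

Let tF : subtree e S F. Proof. by case: set_q. Qed.
Let Fe : F \subset edges e. Proof. by have [] := subtreeP _ _ _ tF. Qed.

Let N := assemble S F q.

Lemma settled_card_gt1 : 1 < #|S|.
Proof.
have [_ gt1 _ _] := set_q; apply: leq_trans gt1 _.
apply/subset_leq_card/subsetP => u; rewrite inE => leaf_u.
have /(deg_gt0P e_sym _ Fe)[w uw]: 0 < deg F u by rewrite (eqP leaf_u).
by have /andP[] := subtree_adj_in tF uw.
Qed.

Lemma adj_assemble_out x y : x \notin S -> adj (treeE N) x y = (q x == [set y]).
Proof.
move=> xS; have [_ _ _ /(_ _ xS)] := set_q => /andP[place_x /forall_inP adj_x].
rewrite adjE !inE; apply/orP/eqP.
  case=> [xy | /imsetP[v]].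
    by have /andP[] := subtree_adj_in tF xy; rewrite (negPf xS).
  rewrite !inE negb_or => /andP[vS vB] eq_xy.
  have [_ _ _ /(_ _ vS)] := set_q => /andP[/orP[vF | place_v] _].
    by rewrite vS vF in vB.
  case/exists_inP: place_v => z Sz /eqP eqz; rewrite eqz in eq_xy.
  have: x \in [set v; z] by rewrite -eq_xy set21.
  rewrite !inE => /orP[]/eqP eqx; last by rewrite eqx Sz in xS.
  by rewrite eqx in eq_xy *; rewrite eqz (set2_injr eq_xy).
move=> eq_q; right; apply/imsetP; exists x; last by rewrite eq_q.
rewrite !inE (negPf xS) eq_q /=; apply: contraTN isT => Fy.
by have /eqP := edge_neq_set1 e_sym e_irr y Fe Fy.
Qed.

Lemma adj_assemble_in x y : x \in S -> y \in S ->
  adj (treeE N) x y = adj F x y.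
Proof.
move=> xS yS; rewrite !adjE inE; case: (_ \in F) => //=.
apply/imsetP => -[v]; rewrite !inE negb_or => /andP[vS _] eq_xy.
have: v \in [set x; y] by rewrite eq_xy setU11.
by rewrite !inE => /orP[]/eqP eqv; rewrite eqv ?xS ?yS in vS.
Qed.

Lemma treeE_assemble_edges : treeE N \subset edges e.
Proof.
rewrite subUset Fe /=; apply/subsetP => _ /imsetP[v vSB ->].
move: vSB; rewrite !inE negb_or => /andP[vS].
have [_ _ _ /(_ _ vS)] := set_q => /andP[/orP[-> | /exists_inP[z _ /eqP->]]].
  by rewrite vS.
move=> /forall_inP/(_ z); rewrite set11 => /(_ isT) evz _.
by apply/imsetP; exists (v, z); rewrite ?inE.
Qed.
Let Te := treeE_assemble_edges.

Lemma treeE_assemble_sub f : f \in treeE N -> f \subset vertA N.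
Proof.
have SA : S \subset vertA N.
  by apply/subsetP => x xS; rewrite !inE xS.
rewrite inE => /orP[Ff | /imsetP[v vSB ->]].
  by have [_ FS _ _] := subtreeP _ _ _ tF; apply: subset_trans (FS _ Ff) SA.
have := vSB; rewrite !inE negb_or => /andP[vS vB].
rewrite subUset sub1set !inE vB.
have [_ _ _ /(_ _ vS)] := set_q => /andP[/orP[vF | /exists_inP[z Sz /eqP->]] _].
  by rewrite vS vF in vB.
by rewrite sub1set (subsetP SA).
Qed.

Lemma assemble_connected :
  {in vertA N &, forall x y, connect (adj (treeE N)) x y}.
Proof.
have cs := sym_connect_sym (adj_sym (treeE N)).
have to_spine x : x \in vertA N ->
    exists2 y, y \in S & connect (adj (treeE N)) x y.
  case: (boolP (x \in S)) => [xS _ | xS]; first by exists x.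
  rewrite !inE xS /=; have [_ _ _ /(_ _ xS)] := set_q => /andP[/orP[-> // | ]].
  case/exists_inP=> z Sz /eqP eqz _ _; exists z => //; apply: connect1.
  by rewrite adj_assemble_out // eqz.
move=> x y /to_spine[x' Sx xx'] /to_spine[y' Sy yy'].
apply: (connect_trans xx'); rewrite cs; apply: (connect_trans yy').
have [_ _ cF _] := subtreeP _ _ _ tF.
apply: connect_sub (cF _ _ Sy Sx) => a b ab; apply: connect1.
by have /andP[Sa Sb] := subtree_adj_in tF ab; rewrite adj_assemble_in.
Qed.

(** A vertex of [S] with a single neighbour in the spine is a leaf of the spine,
    and its guard hangs there as a second neighbour in the tree. *)
Lemma deg_assemble x : (1 < deg (treeE N) x) = (x \in S).
Proof.
have [_ _ all_guarded _] := set_q.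
apply/idP/idP => [/(deg_gt1P e_sym _ Te)[y [z [neq_yz xy xz]]] | xS].
  apply: contraNT neq_yz => xS; move: xy xz; rewrite !adj_assemble_out //.
  by move=> /eqP-> /eqP/set1_inj->.
have gt0 := subtree_deg_gt0 e_sym tF settled_card_gt1 xS.
have [le1 | gt1] := leqP (deg F x) 1; last first.
  by apply: leq_trans gt1 _; apply: deg_sub; apply: subsetUl.
have leaf_x : leaf F x by rewrite /leaf eqn_leq le1.
have /andP[_ /existsP[v /and3P[vS qv _]]] := all_guarded _ leaf_x.
have [y xy] := deg_gt0P e_sym x Fe gt0.
have /andP[_ yS] := subtree_adj_in tF xy.
apply/(deg_gt1P e_sym _ Te); exists v, y; split.
- by apply: contraNneq vS => ->.
- by rewrite adj_sym adj_assemble_out.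
- by rewrite adj_assemble_in.
Qed.

(** All vertices of a cycle have degree at least two, so that they are in [S] and
    the cycle is one of [F]. *)
Lemma assemble_acyclic : acyclic (treeE N).
Proof.
apply/acyclicP => s s3 us; apply/negP => cyc.
have sS x : x \in s -> x \in S.
  by move=> xs; rewrite -deg_assemble (cycle_deg e_sym Te s3 us cyc xs).
have [_ _ _ /acyclicP/(_ s s3 us)/negP[]] := subtreeP _ _ _ tF.
rewrite -(eq_in_cycle (P := [in S]) (e := adj (treeE N))) //.
  by move=> x y xS yS; rewrite adj_assemble_in.
by apply/allP.
Qed.

Lemma assemble_is_realignment : is_realignment e N.
Proof.
have [_ _ _ places] := set_q; apply/and3P; split.
- apply: leq_trans settled_card_gt1 _; apply/subset_leq_card/subsetP => x xS.
  by rewrite !inE xS.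
- apply/subtreeP; split.
  + exact: Te.
  + exact: treeE_assemble_sub.
  + exact: assemble_connected.
  + exact: assemble_acyclic.
- apply/forallP => b; rewrite ffunE; case: ifP => bB; last by rewrite inE bB.
  rewrite inE bB /=; move: bB; rewrite inE => /andP[bS bF].
  by rewrite inE bF; have /andP[_ ->] := places b bS.
Qed.

Lemma im_r_assemble : im_r N \subset F.
Proof.
apply/subsetP => f; rewrite inE => /existsP[b]; rewrite ffunE.
by case: ifP => // + /eqP[<-]; rewrite inE => /andP[].
Qed.

Lemma interior_assemble : interior N = S.
Proof. by apply/setP => x; rewrite inE deg_assemble. Qed.

Lemma spineV_assemble : spineV N = S.
Proof.
rewrite /spineV interior_assemble; apply/setUidPl/bigcupsP => f fr.
have [_ FS _ _] := subtreeP _ _ _ tF.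
exact: FS (subsetP im_r_assemble _ fr).
Qed.

Lemma spineE_assemble : spineE N = F.
Proof.
have [_ FS _ _] := subtreeP _ _ _ tF.
apply/eqP; rewrite eqEsubset subUset im_r_assemble interior_assemble andbT.
apply/andP; split; apply/subsetP => f.
  rewrite inE => /andP[+ fS]; rewrite inE => /orP[// | /imsetP[v]].
  rewrite !inE negb_or => /andP[vS _] eqf.
  by have := subsetP fS v; rewrite eqf setU11 (negPf vS) => /(_ isT).
by move=> Ff; rewrite !inE Ff interior_assemble FS.
Qed.

Lemma leaf_nbr_assemble v u : v \notin S -> q v = [set u] ->
  leaf_nbr (treeE N) v = u.
Proof.
move=> vS qv; apply: leaf_nbr_eq => y; rewrite adj_assemble_out // qv.
by rewrite eq_sym; apply/eqP/eqP => [/set1_inj | ->].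
Qed.

Lemma anchor_assemble : {in ~: S, anchor N =1 q}.
Proof.
move=> v; rewrite inE => vS; rewrite /anchor ffunE inE vS /=.
case: ifP => // vF; have [_ _ _ /(_ _ vS)] := set_q; rewrite /placement vF /=.
case/andP=> /exists_inP[z _ /eqP qv] _.
by rewrite (leaf_nbr_assemble vS qv).
Qed.

Lemma occupied_assemble u : occupied e N u = leaf F u.
Proof.
rewrite /occupied spineE_assemble spineV_assemble.
case: (boolP (leaf F u)) => //= leaf_u.
have [_ _ /(_ u leaf_u)/andP[_ /existsP[v /and3P[vS /eqP qv bar]]] _] := set_q.
apply/exists_inP; exists v; last by rewrite (leaf_nbr_assemble vS qv) eqxx.
rewrite !inE vS qv /=; apply: contraTN isT => Fu.
by have /eqP := edge_neq_set1 e_sym e_irr u Fe Fu.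
Qed.

Lemma assemble_in_R :
  exists2 M : realignment e, realign_val M = N & M \in R_ e.
Proof.
exists (Realignment assemble_is_realignment) => //.
rewrite !inE /= -/N.
have -> : [set u | occupied e N u] = [set u | leaf F u].
  by apply/setP => u; rewrite !inE occupied_assemble.
have [_ gt1 _ _] := set_q; rewrite leqNgt gt1 andbF /= /minimal_spine.
rewrite spineE_assemble; apply/orP; right; apply/forallP => u.
by rewrite occupied_assemble implybb.
Qed.

End Settled.

End Assembly.

(** * Every cell of R is assembled from its spine *)

Section Structure.

Variables (V : finType) (e : rel V).
Hypotheses (e_sym : symmetric e) (e_irr : irreflexive e).
Variable N : realignment e.
Hypothesis N_in_R : N \in R_ e.

Let A := vertA N.
Let T := treeE N.

Let A2 : 1 < #|A|.
Proof. by rewrite /A; case: N => [[[A' T'] r] /= /and3P[]]. Qed.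

Let tT : subtree e A T.
Proof. by rewrite /A /T; case: N => [[[A' T'] r] /= /and3P[]]. Qed.

Let Te : T \subset edges e. Proof. by have [] := subtreeP _ _ _ tT. Qed.

Lemma rmapP b : if rmap N b is Some f
  then [&& b \notin A, f \in T & [forall v in f, e b v]] else b \in A.
Proof. by rewrite /A /T; case: N => [[[A' T'] r] /= /and3P[_ _ /forallP/(_ b)]]. Qed.

Lemma rmap_vertA b : b \in A -> rmap N b = None.
Proof. by move=> Ab; case: (rmap N b) (rmapP b) => // f /and3P[]; rewrite Ab. Qed.

Lemma spineE_sub_treeE : spineE N \subset T.
Proof.
apply/subsetP => f; rewrite !inE => /orP[/andP[] // | /existsP[b /eqP rb]].
by have := rmapP b; rewrite rb => /and3P[].
Qed.

Let Se : spineE N \subset edges e.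
Proof. exact: subset_trans spineE_sub_treeE Te. Qed.

Lemma spineE_sub_spineV f : f \in spineE N -> f \subset spineV N.
Proof.
rewrite in_setU => /orP[ | fr].
  by rewrite inE => /andP[_ sf]; apply: subset_trans sf (subsetUl _ _).
by apply: subset_trans (subsetUr _ _); apply: (bigcup_sup f).
Qed.

Lemma noninterior_leaf v : v \in A -> v \notin interior N -> leaf T v.
Proof.
move=> Av; rewrite inE -leqNgt /leaf eqn_leq => ->.
by rewrite (subtree_deg_gt0 e_sym tT).
Qed.

(** The tree neighbours of [u] include the occupying vertex and one inside the
    spine. *)
Lemma occupied_interior u : occupied e N u -> u \in interior N.
Proof.
case/andP=> leaf_u /exists_inP[v]; rewrite inE => /andP[vS Av] /andP[/eqP nbr_v _].
have [y uy]: exists y, adj (spineE N) u y.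
  by apply/(deg_gt0P e_sym _ Se); rewrite (eqP leaf_u).
have leaf_v : leaf T v.
  apply: noninterior_leaf => //; apply: contra vS => vI.
  by rewrite inE vI.
rewrite inE; apply/(deg_gt1P e_sym _ Te); exists v, y; split.
- apply: contraNneq vS => ->.
  by apply: (subsetP (spineE_sub_spineV uy)); rewrite set22.
- by rewrite adj_sym (adj_leaf e_sym _ Te leaf_v) nbr_v.
- exact: (subsetP spineE_sub_treeE).
Qed.

Let occupied_gt1 : 1 < #|[set u | occupied e N u]|.
Proof. by move: N_in_R; rewrite !inE leqNgt; case: (1 < _); rewrite ?andbT ?andNb. Qed.

(** Minimality says this unless the spine has at most one edge. In that case two
    occupied leaves, which exist in the complement of [M_ e], are already the two
    ends of that edge. *)
Lemma spine_leaf_occupied u : leaf (spineE N) u -> occupied e N u.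
Proof.
have : minimal_spine e N by move: N_in_R; rewrite !inE => /andP[].
case/orP=> [/card_le1_eqP le1 leaf_u | /forallP/(_ u)/implyP //].
have leaf_edge w : leaf (spineE N) w -> exists2 f, f \in spineE N & w \in f.
  move=> leaf_w; have /(deg_gt0P e_sym _ Se)[x wx] : 0 < deg (spineE N) w.
    by rewrite (eqP leaf_w).
  by exists [set w; x] => //; rewrite set21.
have [u1 [u2 [/[!inE] occ1 occ2 neq_u]]] := card_gt1P occupied_gt1.
have [/leaf_edge[f1 Sf1 uf1] _] := andP occ1.
have [/leaf_edge[f2 Sf2 uf2] _] := andP occ2.
have [f Sf uf] := leaf_edge u leaf_u.
rewrite (le1 f1 f2 Sf1 Sf2) in uf2; rewrite (le1 f1 f Sf1 Sf) in uf.
have [w eq_f _] := edge_at e_sym Se Sf1 uf1; rewrite eq_f in uf uf2.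
move: uf uf2; rewrite !inE [u2 == _]eq_sym (negPf neq_u) /=.
by case/orP=> /eqP-> // /eqP<-.
Qed.

(** A vertex of an edge of [im_r N] that were a leaf of the tree would be a leaf
    of the spine, hence occupied, hence interior. *)
Lemma im_r_sub_interior : cover (im_r N) \subset interior N.
Proof.
apply/bigcupsP => f fr; apply/subsetP => x xf.
have Sf : f \in spineE N by rewrite in_setU fr orbT.
apply: contraT => xI; rewrite -(negbTE xI); apply: occupied_interior.
apply: spine_leaf_occupied; apply: (leaf_of_le1 e_sym Se).
  by apply: leq_trans (deg_sub _ spineE_sub_treeE) _; rewrite leqNgt; rewrite inE in xI.
by have [w eq_f _] := edge_at e_sym Se Sf xf; exists w; rewrite adjE -eq_f.
Qed.

Lemma spineV_interior : spineV N = interior N.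
Proof. exact/setUidPl/im_r_sub_interior. Qed.

Lemma spineE_interior f : (f \in spineE N) = (f \in T) && (f \subset interior N).
Proof.
apply/idP/andP => [Sf | [Tf fI]]; last by rewrite in_setU inE Tf fI.
by rewrite -spineV_interior spineE_sub_spineV // (subsetP spineE_sub_treeE).
Qed.

Lemma spineV_sub_vertA : spineV N \subset A.
Proof.
rewrite spineV_interior; apply/subsetP => x.
rewrite inE => /(deg_gt1P e_sym _ Te)[y [_ [_ xy _]]].
by have /andP[] := subtree_adj_in tT xy.
Qed.

Let nonempty_interior : exists x, 1 < deg T x.
Proof.
have [u [_ [/[!inE] occ _ _]]] := card_gt1P occupied_gt1.
by have := occupied_interior occ; rewrite inE; exists u.
Qed.

Lemma nbr_of_noninterior v w : v \notin spineV N -> adj T v w ->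
  w = leaf_nbr T v /\ w \in spineV N.
Proof.
rewrite spineV_interior => vI vw; have /andP[Av _] := subtree_adj_in tT vw.
have leaf_v := noninterior_leaf Av vI; rewrite (adj_leaf e_sym _ Te leaf_v) in vw.
split; first exact/eqP.
have [x x2] := nonempty_interior; rewrite inE.
apply: (leaf_adj_interior e_sym tT x2 (v := v)).
  by rewrite (adj_leaf e_sym _ Te leaf_v).
by rewrite inE -leqNgt in vI.
Qed.

Lemma noninterior_leaf_nbr v : v \in A -> v \notin spineV N ->
  adj T v (leaf_nbr T v) /\ leaf_nbr T v \in spineV N.
Proof.
move=> Av vS; have leaf_v : leaf T v.
  by apply: noninterior_leaf; rewrite -?spineV_interior.
have v_nbr : adj T v (leaf_nbr T v) by rewrite (adj_leaf e_sym _ Te leaf_v).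
by have [] := nbr_of_noninterior vS v_nbr.
Qed.

(** Sending each leaf of the tree to its neighbour retracts the tree onto the
    spine, and maps paths to paths with possible pauses. *)
Lemma spine_connected :
  {in spineV N &, forall x y, connect (adj (spineE N)) x y}.
Proof.
pose proj x := if x \in spineV N then x else leaf_nbr T x.
have proj_adj x z : adj T x z -> connect (adj (spineE N)) (proj x) (proj z).
  move=> xz; rewrite /proj.
  case: (boolP (x \in spineV N)) => [xS | xS]; last first.
    by have [<- ->] := nbr_of_noninterior xS xz.
  case: (boolP (z \in spineV N)) => [zS | zS]; last first.
    by rewrite adj_sym in xz; have [<- _] := nbr_of_noninterior zS xz.
  apply: connect1; rewrite adjE spineE_interior -spineV_interior.
  by rewrite -adjE xz subUset !sub1set xS zS.
move=> x y xS yS; have [_ _ cT _] := subtreeP _ _ _ tT.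
have /connectP[p xp y_last] := cT x y (subsetP spineV_sub_vertA _ xS)
  (subsetP spineV_sub_vertA _ yS).
have -> : x = proj x by rewrite /proj xS.
have -> : y = proj y by rewrite /proj yS.
rewrite y_last; elim: p x xp {xS y_last yS} => //= z p IHp x /andP[xz zp].
exact: connect_trans (proj_adj _ _ xz) (IHp z zp).
Qed.

Lemma spine_subtree : subtree e (spineV N) (spineE N).
Proof.
have [_ _ _ acT] := subtreeP _ _ _ tT; apply/subtreeP; split.
- exact: Se.
- exact: spineE_sub_spineV.
- exact: spine_connected.
- exact: acyclic_sub spineE_sub_treeE acT.
Qed.

Lemma anchor_vertA v : v \in A -> anchor N v = [set leaf_nbr T v].
Proof. by move=> Av; rewrite /anchor rmap_vertA. Qed.

Lemma settled_anchor : settled e (spineV N) (spineE N) (anchor N).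
Proof.
split.
- exact: spine_subtree.
- apply: leq_trans occupied_gt1 _; apply/subset_leq_card/subsetP => u.
  by rewrite !inE => /andP[].
- move=> u leaf_u; rewrite /guarded leaf_u /=.
  have /andP[_ /exists_inP[v]] := spine_leaf_occupied leaf_u.
  rewrite inE => /andP[vS Av] /andP[/eqP nbr_v bar].
  by apply/existsP; exists v; rewrite vS anchor_vertA // nbr_v eqxx.
- move=> v vS; rewrite /placement /anchor.
  have := rmapP v; case rv: (rmap N v) => [f|].
    case/and3P=> _ _ ->; rewrite in_setU [f \in im_r _]inE.
    suff -> : [exists b, rmap N b == Some f] by rewrite orbT.
    by apply/existsP; exists v; rewrite rv.
  move=> Av; have [v_nbr nbrS] := noninterior_leaf_nbr Av vS; apply/andP; split.
    by apply/orP; right; apply/exists_inP; exists (leaf_nbr T v).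
  by apply/forall_inP => w /set1P->; apply: (adj_edge e_sym e_irr Te v_nbr).
Qed.

Lemma unspecified_anchor : unspecified (spineV N) (spineE N) (anchor N) = ~: A.
Proof.
apply/setP => v; rewrite [LHS]inE in_setC; apply/andP/idP => [[vS] | vA].
  apply: contraL => Av; rewrite anchor_vertA //; apply: contraTN isT => Sv.
  by have /eqP := edge_neq_set1 e_sym e_irr (leaf_nbr T v) Se Sv.
split; first by apply: contra vA; apply: (subsetP spineV_sub_vertA).
rewrite /anchor; have := rmapP v; case rv: (rmap N v) => [f|]; last first.
  by rewrite (negPf vA).
move=> _; rewrite in_setU orbC inE.
by apply/orP; left; apply/existsP; exists v; rewrite rv.
Qed.

Lemma assemble_anchor :
  realign_val N = assemble (spineV N) (spineE N) (anchor N).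
Proof.
rewrite /assemble unspecified_anchor setCK.
have eqT : T = spineE N :|:
    [set v |: anchor N v | v in ~: (spineV N :|: ~: A)].
  apply/setP => f; rewrite in_setU; apply/idP/orP => [Tf | [Sf | /imsetP[v]]].
  - have [Sf | Sf] := boolP (f \in spineE N); [by left | right].
    move: Sf; rewrite spineE_interior Tf -spineV_interior => /subsetPn[x xf xS].
    have [w eq_f _] := edge_at e_sym Te Tf xf.
    have xw : adj T x w by rewrite adjE -eq_f.
    have /andP[Ax _] := subtree_adj_in tT xw.
    have [eq_w _] := nbr_of_noninterior xS xw.
    apply/imsetP; exists x; first by rewrite !in_setC in_setU in_setC Ax orbF.
    by rewrite anchor_vertA // -eq_w.
  - exact: (subsetP spineE_sub_treeE).
  - rewrite !in_setC in_setU in_setC negb_or negbK => /andP[vS Av] ->.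
    by rewrite anchor_vertA //; have [] := noninterior_leaf_nbr Av vS.
rewrite -eqT.
have -> : [ffun v => if v \in ~: A then Some (anchor N v) else None] = rmap N.
  apply/ffunP => v; rewrite ffunE in_setC /anchor.
  by have := rmapP v; case: (rmap N v) => [f /and3P[->] | ->].
by rewrite /A /T /vertA /treeE /rmap; case: (realign_val N) => [[]].
Qed.

End Structure.

(** * Moving the vertices off the spine inside their components *)

Section Moves.

Variables (V : finType) (e : rel V).
Hypotheses (e_sym : symmetric e) (e_irr : irreflexive e).
Variables (S : {set V}) (F : {set {set V}}).
Implicit Types (p : {set V}) (q : V -> {set V}) (u v w x y : V).

(** The spine without the barriers of [v]; on its vertices, [reach v]
    is the relation of lying in the same component. *)
Definition free v : {set V} := S :\: [set w | barrier e w v].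

Definition reach v : rel V :=
  connect [rel x y | [&& x \in free v, y \in free v & adj F x y]].

Definition relocate q v p : V -> {set V} := fun w => if w == v then p else q w.

(** [q] and [q'] assign the same component to every vertex off the spine. *)
Definition close q q' : Prop :=
  forall v, v \notin S -> {in q v & q' v, forall x y, reach v x y}.

Lemma in_free v x : (x \in free v) = (x \in S) && e v x.
Proof. by rewrite !inE /barrier negbK andbC e_sym. Qed.

Lemma reach_sym v : connect_sym
  [rel x y | [&& x \in free v, y \in free v & adj F x y]].
Proof.
by apply: sym_connect_sym => x y /=; rewrite adj_sym andbCA.
Qed.

Hypothesis tF : subtree e S F.
Let Fe : F \subset edges e. Proof. by have [] := subtreeP _ _ _ tF. Qed.

Lemma placement_free v p : placement e S F v p -> p \subset free v.
Proof.
have [_ FS _ _] := subtreeP _ _ _ tF.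
case/andP=> place_p /forall_inP adj_p; apply/subsetP => x px.
rewrite in_free adj_p // andbT; case/orP: place_p => [/FS/subsetP-> // |].
by case/exists_inP=> z Sz /eqP eq_p; move: px; rewrite eq_p => /set1P->.
Qed.

Lemma placement_reach v p : placement e S F v p ->
  {in p &, forall x y, reach v x y}.
Proof.
move=> place_p x y px py; have /subsetP free_p := placement_free place_p.
have [-> | neq_xy] := eqVneq x y; first exact: connect0.
apply: connect1; rewrite /= !free_p //=.
case/andP: place_p => /orP[Fp | /exists_inP[z _ /eqP eq_p]] _.
  have [w eq_p _] := edge_at e_sym Fe Fp px; move: py; rewrite eq_p.
  by rewrite !inE eq_sym (negPf neq_xy) => /eqP->; rewrite adjE -eq_p.
by move: px py neq_xy; rewrite eq_p => /set1P-> /set1P->; rewrite eqxx.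
Qed.

Lemma placement_nonempty v p : placement e S F v p -> exists x, x \in p.
Proof.
case/andP=> /orP[/(subsetP Fe)/imsetP[[a b] _ ->] | /exists_inP[z _ /eqP->]] _.
  by exists a; rewrite set21.
by exists z; rewrite set11.
Qed.

Lemma placement_set1 v x : x \in free v -> placement e S F v [set x].
Proof.
rewrite in_free => /andP[Sx vx]; apply/andP; split.
  by apply/orP; right; apply/exists_inP; exists x.
by apply/forall_inP => w /set1P->.
Qed.

Lemma placement_set2 v x y : x \in free v -> y \in free v -> adj F x y ->
  placement e S F v [set x; y].
Proof.
rewrite !in_free => /andP[_ vx] /andP[_ vy] xy; apply/andP; split.
  by rewrite -adjE xy.
by apply/forall_inP => w /set2P[]->.
Qed.

(** The only spine edge at the leaf [u] leads to a barrier of [v]. *)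
Lemma guard_fixed u v y : leaf F u -> ~~ e (leaf_nbr F u) v ->
  reach v u y -> y = u.
Proof.
move=> leaf_u bar /connectP[[|z p] /= path_p -> //].
move: path_p => /andP[/and3P[_ + uz] _].
rewrite (adj_leaf e_sym _ Fe leaf_u) in uz; rewrite (eqP uz) in_free e_sym.
by rewrite (negPf bar) andbF.
Qed.

(** Guards are the only vertices on which the leaf condition depends, and they
    have the same place in [q] and [q']. *)
Lemma settled_close q q' : settled e S F q ->
  (forall v, v \notin S -> placement e S F v (q' v)) -> close q q' ->
  settled e S F q'.
Proof.
move=> [_ gt1 all_guarded places] places' close_qq'; split=> // u leaf_u.
have /andP[_ /existsP[v /and3P[vS /eqP qv bar]]] := all_guarded u leaf_u.
rewrite /guarded leaf_u; apply/existsP; exists v; rewrite vS bar andbT /=.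
have [x q'x] := placement_nonempty (places' v vS).
have q'u y : y \in q' v -> y = u.
  move=> q'y; apply: (guard_fixed leaf_u bar).
  by apply: close_qq'; rewrite ?qv ?set11.
rewrite eqEsubset sub1set -{2}(q'u x q'x) q'x andbT.
by apply/subsetP => y /q'u->; rewrite set11.
Qed.

Lemma settled_reach q v : settled e S F q -> v \notin S ->
  {in q v &, forall x y, reach v x y}.
Proof. by move=> [_ _ _ places] /places/placement_reach. Qed.

Lemma settled_relocate q v p : settled e S F q -> v \notin S ->
  placement e S F v p -> {in q v & p, forall x y, reach v x y} ->
  settled e S F (relocate q v p).
Proof.
move=> set_q vS place_p close_p; have [_ _ _ places] := set_q.
apply: (settled_close set_q) => w wS; rewrite /relocate; case: eqP => [-> // | _].
- exact: places.
- exact: settled_reach.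
Qed.

Lemma specify_assemble q v x : v \notin S -> q v \in F -> x \in q v ->
  specify (assemble S F q) v x = assemble S F (relocate q v [set x]).
Proof.
move=> vS Fv xv; set q' := relocate q v [set x].
have q'v : q' v = [set x] by rewrite /q' /relocate eqxx.
have q'w w : w != v -> q' w = q w by rewrite /q' /relocate => /negPf->.
have eqB : unspecified S F q' = unspecified S F q :\ v.
  apply/setP => w; rewrite !inE; have [-> | /q'w-> //] := eqVneq w v.
  rewrite q'v; apply/negP => /andP[_ Fx].
  by have /eqP := edge_neq_set1 e_sym e_irr x Fe Fx.
have vB : v \in unspecified S F q by rewrite inE vS.
rewrite /specify /assemble eqB /vertA /treeE /rmap /=; congr (_, _, _).
- by apply/setP => w; rewrite !in_setU !in_setC in_setD1 negb_and negbK in_set1.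
- rewrite setUCA; congr (_ :|: _).
  have -> : ~: (S :|: unspecified S F q :\ v) =
      v |: ~: (S :|: unspecified S F q).
    apply/setP => w; rewrite !(in_setU, in_setC, in_setD1, in_set1).
    by have [-> | //] := eqVneq w v; rewrite (negPf vS).
  rewrite imsetU1 q'v; congr (_ |: _).
    by rewrite setUC.
  apply: eq_in_imset => w; rewrite in_setC in_setU negb_or => /andP[_ wB].
  by rewrite q'w //; apply: contraNneq wB => ->.
- apply/ffunP => w; rewrite !ffunE in_setD1.
  by have [-> | /q'w->] := eqVneq w v.
Qed.

(** The two cells are existentially quantified so that [q] and [q'] stay plain
    functions, free of proofs of [settled]; a cell being determined by its value,
    chains still compose. *)
Definition linked q q' : Prop := exists N N' : realignment e,
  [/\ realign_val N = assemble S F q, realign_val N' = assemble S F q' &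
      same_component (R_ e) N N'].

Lemma same_component_sym : connect_sym [rel N N' : realignment e |
  [&& N \in R_ e, N' \in R_ e & face N N' || face N' N]].
Proof. by apply: sym_connect_sym => N N' /=; rewrite andbCA orbC. Qed.

Lemma eq_linked q q' : settled e S F q -> {in ~: S, q =1 q'} -> linked q q'.
Proof.
move=> set_q eq_q; have [N eqN _] := assemble_in_R e_sym e_irr set_q.
by exists N, N; split; rewrite -?(eq_assemble _ eq_q) //; apply: connect0.
Qed.

Lemma linked_sym q q' : linked q q' -> linked q' q.
Proof.
case=> N [N' [eqN eqN' comp]]; exists N', N; split=> //.
by rewrite /same_component same_component_sym.
Qed.

Lemma linked_trans q1 q2 q3 : linked q1 q2 -> linked q2 q3 -> linked q1 q3.
Proof.
case=> N1 [N2 [eqN1 eqN2 comp12]] [N2' [N3 [eqN2' eqN3 comp23]]].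
have eqN : N2 = N2' by apply: val_inj; rewrite /= eqN2 eqN2'.
by exists N1, N3; split=> //; apply: connect_trans comp12 _; rewrite eqN.
Qed.

(** This is a specification when [q v] is an edge, and the constant chain when
    [q v] is a single vertex. *)
Lemma linked_collapse q v x : settled e S F q -> v \notin S -> x \in q v ->
  linked q (relocate q v [set x]).
Proof.
move=> set_q vS xv; have [_ _ _ /(_ v vS) place_v] := set_q.
have x_free : x \in free v by apply: subsetP (placement_free place_v) x xv.
case/andP: place_v => /orP[Fv | /exists_inP[z _ /eqP qv]] _; last first.
  apply: eq_linked => // w _; rewrite /relocate; case: eqP => // ->.
  by move: xv; rewrite qv => /set1P->.
have [N eqN RN] := assemble_in_R e_sym e_irr set_q.
have set_q' : settled e S F (relocate q v [set x]).
  apply: settled_relocate => //; first exact: placement_set1.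
  by move=> y _ qy /set1P->; apply: (settled_reach set_q).
have [N' eqN' RN'] := assemble_in_R e_sym e_irr set_q'.
exists N, N'; split=> //; apply: connect1; rewrite /= RN RN' orbC /face.
rewrite connect1 //; apply/existsP; exists v; apply/existsP; exists x.
rewrite eqN eqN' specify_assemble // eqxx andbT /rmap /= ffunE inE vS Fv.
exact: xv.
Qed.

(** Each edge [x]--[z] of the path is crossed through the cell in which [v]
    occupies [[set x; z]]: both of the placements [[set x]] and [[set z]] are
    specifications of it. *)
Lemma linked_reach v x y : v \notin S -> reach v x y ->
  forall q, settled e S F q -> q v = [set x] -> linked q (relocate q v [set y]).
Proof.
move=> vS /connectP[p path_p ->] {y}; elim: p x path_p => /= [|z p IHp] x path_p q.
  move=> set_q qv; apply: eq_linked => // w _; rewrite /relocate.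
  by case: eqP => // ->.
case/andP: path_p => /and3P[x_free z_free xz] path_p set_q qv.
have close_z w : w \in [set x; z] -> reach v x w.
  case/set2P=> ->; first exact: connect0.
  by apply: connect1; rewrite /= x_free z_free.
pose qxz := relocate q v [set x; z]; pose qz := relocate q v [set z].
have set_qxz : settled e S F qxz.
  apply: settled_relocate => //; first exact: placement_set2.
  by move=> x' w; rewrite qv => /set1P-> /close_z.
have set_qz : settled e S F qz.
  apply: settled_relocate => //; first exact: placement_set1.
  by move=> x' w; rewrite qv => /set1P-> /set1P->; apply: close_z; rewrite set22.
have link_xz : linked q qxz.
  apply: linked_sym; have xv : x \in qxz v by rewrite /qxz /relocate eqxx set21.
  apply: linked_trans (linked_collapse set_qxz vS xv) _.
  apply: eq_linked => [|w _].
    apply: settled_relocate => //; first exact: placement_set1.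
    move=> w x'; rewrite /qxz /relocate eqxx => /close_z + /set1P->.
    by rewrite /reach reach_sym.
  by rewrite /qxz /relocate; case: eqP => // ->.
have link_z : linked qxz qz.
  have zv : z \in qxz v by rewrite /qxz /relocate eqxx set22.
  apply: linked_trans (linked_collapse set_qxz vS zv) _.
  apply: linked_sym; apply: eq_linked => // w _.
  by rewrite /qz /qxz /relocate; case: eqP.
apply: linked_trans link_xz _; apply: linked_trans link_z _.
have qzv : qz v = [set z] by rewrite /qz /relocate eqxx.
apply: linked_trans (IHp z path_p qz set_qz qzv) _.
have y_free : last z p \in free v.
  elim/last_ind: p path_p {IHp} => //= p w _.
  by rewrite rcons_path last_rcons => /andP[_ /and3P[]].
have reach_y : reach v z (last z p) by apply/connectP; exists p.
apply: eq_linked => [|w _]; last by rewrite /qz /relocate; case: eqP.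
apply: settled_relocate => //; first exact: placement_set1.
by move=> z' y'; rewrite qzv => /set1P-> /set1P->.
Qed.

Lemma linked_relocate q v p : settled e S F q -> v \notin S ->
  placement e S F v p -> {in q v & p, forall x y, reach v x y} ->
  linked q (relocate q v p).
Proof.
move=> set_q vS place_p close_p; have [_ _ _ /(_ v vS) place_v] := set_q.
have [x xv] := placement_nonempty place_v.
have [y yp] := placement_nonempty place_p.
have set_p := settled_relocate set_q vS place_p close_p.
have link_x := linked_collapse set_q vS xv.
have yv : y \in relocate q v p v by rewrite /relocate eqxx.
have set_x : settled e S F (relocate q v [set x]).
  apply: settled_relocate => //.
    by apply: placement_set1; apply: subsetP (placement_free place_v) x xv.
  by move=> x' _ qx' /set1P->; apply: (settled_reach set_q).
have set_y : settled e S F (relocate q v [set y]).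
  apply: settled_relocate => //.
    by apply: placement_set1; apply: subsetP (placement_free place_p) y yp.
  by move=> x' _ qx' /set1P->; apply: close_p.
have xx : relocate q v [set x] v = [set x] by rewrite /relocate eqxx.
apply: linked_trans link_x _.
apply: linked_trans (linked_reach vS (close_p x y xv yp) set_x xx) _.
apply: linked_sym; apply: linked_trans (linked_collapse set_p vS yv) _.
apply: linked_trans (_ : linked (relocate q v [set y]) _).
  by apply: linked_sym; apply: eq_linked => // w _; rewrite /relocate; case: eqP.
by apply: eq_linked => // w _; rewrite /relocate; case: eqP.
Qed.

(** Vertices are moved one at a time: [mix s] has moved those of the list
    [s]. *)
Lemma linked_close q q' : settled e S F q -> settled e S F q' ->
  close q q' -> linked q q'.
Proof.
move=> set_q set_q' close_qq'.
have [_ _ _ places] := set_q; have [_ _ _ places'] := set_q'.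
pose mix (s : seq V) v := if v \in s then q' v else q v.
have set_mix s : settled e S F (mix s).
  apply: (settled_close set_q) => v vS; rewrite /mix; case: ifP => _.
  - exact: places'.
  - exact: places.
  - exact: close_qq'.
  - exact: settled_reach.
have link_mix s : linked q (mix s).
  elim: s => [|a s IHs]; first exact: eq_linked.
  apply: linked_trans IHs _; case: (boolP (a \in S)) => [aS | aS].
    apply: eq_linked => // v; rewrite in_setC /mix inE => vS.
    by case: eqP => // eq_v; rewrite eq_v aS in vS.
  apply: linked_trans (_ : linked (relocate (mix s) a (q' a)) _).
    apply: linked_relocate => //; first exact: places'.
    rewrite /mix; case: ifP => _; last exact: close_qq'.
    exact: settled_reach.
  apply: linked_sym; apply: eq_linked => // v _.
  by rewrite /mix /relocate inE; case: eqP => // ->.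
apply: linked_trans (link_mix (enum V)) _; apply: eq_linked => // v _.
by rewrite /mix mem_enum.
Qed.

End Moves.

(** * Connected components of R *)

Section Components.

Variables (V : finType) (e : rel V).
Hypotheses (e_sym : symmetric e) (e_irr : irreflexive e).
Implicit Types N : realignment e.

(** The choice in [spine_assignment] is forced: [x] lies in a single component,
    and this one contains all of [anchor N v]. *)
Lemma spine_assignmentE N v x : N \in R_ e -> v \notin spineV N ->
  x \in anchor N v -> spine_assignment e N v =
  [set y in free e (spineV N) v | reach e (spineV N) (spineE N) v x y].
Proof.
move=> RN vS xv; have set_N := settled_anchor e_sym e_irr RN.
have [tN _ _ /(_ v vS) place_v] := set_N.
have /subsetP free_v := placement_free e_sym tN place_v.
have reach_v := placement_reach e_sym tN place_v.
rewrite /spine_assignment /spine_components.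
set C := [set y in _ | _ ]; set K := equivalence_partition _ _.
have CK : C \in K by apply/imsetP; exists x; rewrite ?free_v.
case: pickP => [C' | /(_ C)]; last first.
  rewrite CK => /negP[]; apply/subsetP => y yv.
  by rewrite inE free_v // reach_v.
case/andP=> /imsetP[z Dz ->] /subsetP/(_ x xv); rewrite !inE => /andP[_ zx] /=.
apply/setP => y; rewrite !inE; congr (_ && _).
exact: same_connect (reach_sym _ _ _ _) _ _ zx y.
Qed.

Lemma same_assignmentP N N' : N \in R_ e -> N' \in R_ e -> same_spine N N' ->
  same_assignment e N N' <->
  close e (spineV N) (spineE N) (anchor N) (anchor N').
Proof.
move=> RN RN' [eqV eqE].
have [tN _ _ places] := settled_anchor e_sym e_irr RN.
have [tN' _ _ places'] := settled_anchor e_sym e_irr RN'.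
split=> [[_ eq_c] v vS x y xv yv | close_NN'].
  have yD : y \in free e (spineV N) v.
    rewrite eqV in vS *.
    exact: (subsetP (placement_free e_sym tN' (places' v vS))).
  have: v \in Z_ N by rewrite in_setC.
  move/eq_c; rewrite (spine_assignmentE RN vS xv).
  rewrite (spine_assignmentE RN' _ yv) -?eqV // -eqE => /setP eq_C.
  have: y \in [set z in free e (spineV N) v | reach e (spineV N) (spineE N) v x z].
    by rewrite eq_C inE yD; apply: connect0.
  by rewrite inE => /andP[].
split=> [|v]; first by rewrite /Z_ eqV.
rewrite in_setC => vS; have vS' := vS; rewrite eqV in vS'.
have [x xv] := placement_nonempty tN (places v vS).
have [y yv] := placement_nonempty tN' (places' v vS').
rewrite (spine_assignmentE RN vS xv) (spine_assignmentE RN' vS' yv) -eqV -eqE.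
apply/setP => z; rewrite [LHS]inE [RHS]inE; congr (_ && _).
exact: same_connect (reach_sym _ _ _ _) _ _ (close_NN' v vS x y xv yv) z.
Qed.

(** [R_ e] is closed under specification, so that chains of faces that start in
    it stay in it. *)
Lemma gen_succ_R N N' : N \in R_ e -> gen_succ N N' ->
  [/\ N' \in R_ e, same_spine N N' & same_assignment e N N'].
Proof.
move=> RN /existsP[b /existsP[v /andP[+ /eqP eqN']]].
case rb: (rmap N b) => [f|] // vf.
have set_N := settled_anchor e_sym e_irr RN; have [tN _ _ places] := set_N.
have eqN := assemble_anchor e_sym e_irr RN.
have bB : b \in unspecified (spineV N) (spineE N) (anchor N).
  rewrite unspecified_anchor // in_setC.
  by have := rmapP N b; rewrite rb => /and3P[].
have anchor_b : anchor N b = f by rewrite /anchor rb.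
have vb : v \in anchor N b by rewrite anchor_b.
move: (bB); rewrite inE => /andP[bS Fb].
rewrite eqN (specify_assemble e_sym e_irr tN) // in eqN'.
have set_N' : settled e (spineV N) (spineE N) (relocate (anchor N) b [set v]).
  apply: settled_relocate => //.
    apply: placement_set1 => //.
    exact: (subsetP (placement_free e_sym tN (places b bS))).
  by move=> x _ xb /set1P->; apply: (settled_reach e_sym tN set_N bS).
have [M eqM RM] := assemble_in_R e_sym e_irr set_N'.
have <- : M = N' by apply: val_inj; rewrite /= eqM eqN'.
have sameS : same_spine N M.
  by split; rewrite eqM ?(spineV_assemble e_sym e_irr set_N')
                        ?(spineE_assemble e_sym e_irr set_N').
split=> //; apply/same_assignmentP => // w wS x y xw.
rewrite eqM (anchor_assemble e_sym e_irr set_N') ?in_setC // /relocate.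
case: eqP => [eq_w | _]; last exact: (settled_reach e_sym tN set_N wS).
by move/set1P->; apply: (settled_reach e_sym tN set_N wS); rewrite // eq_w.
Qed.

Lemma face_same N N' : N \in R_ e -> face N' N ->
  same_spine N N' /\ same_assignment e N N'.
Proof.
move=> + /connectP[p path_p ->]; elim: p N path_p => //= M p IHp N.
case/andP=> NM path_p RN; have [RM [eqV eqE] [eqZ eq_c]] := gen_succ_R RN NM.
have [[eqV' eqE'] [eqZ' eq_c']] := IHp M path_p RM.
do 2?split; rewrite ?eqV ?eqE ?eqZ // => v vZ.
by rewrite eq_c ?eqZ // eq_c'.
Qed.

End Components.

Theorem proposition2p37 (V : finType) (e : rel V)
  (e_sym : symmetric e) (e_irr : irreflexive e)
  (e_conn : forall x y : V, connect e x y) (n_ge3 : 3 <= #|V|)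
  (N N' : realignment e) (N_in_R : N \in R_ e) (N'_in_R : N' \in R_ e) :
  same_component (R_ e) N N' <->
  same_spine N N' /\ same_assignment e N N'.
Proof.
split=> [/connectP[p path_p ->] | [[eqV eqE] eq_c]].
  elim: p N path_p {N_in_R} => //= M p IHp N.
  case/andP=> /and3P[RN RM facing] path_p.
  have [[eqV eqE] [eqZ eq_c]] := IHp M path_p.
  have [[eqV' eqE'] [eqZ' eq_c']] : same_spine N M /\ same_assignment e N M.
    case/orP: facing => [/(face_same e_sym e_irr RM) | /(face_same e_sym e_irr RN) //].
    case=> -[eqV' eqE'] [eqZ' eq_c']; do 2?split=> //.
    by move=> v vZ; rewrite -eq_c' ?eqZ'.
  do 2?split; rewrite ?eqV' ?eqE' ?eqZ' // => v vZ.
  by rewrite eq_c' ?eqZ' // eq_c.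
have close_NN' := (same_assignmentP e_sym e_irr N_in_R N'_in_R (conj eqV eqE)).1 eq_c.
have set_N := settled_anchor e_sym e_irr N_in_R; have [tN _ _ _] := set_N.
have set_N' := settled_anchor e_sym e_irr N'_in_R.
have eqN := assemble_anchor e_sym e_irr N_in_R.
have eqN' := assemble_anchor e_sym e_irr N'_in_R.
rewrite -eqV -eqE in set_N' eqN'.
have [M [M' [eqM eqM' comp]]] := linked_close e_sym e_irr tN set_N set_N' close_NN'.
have -> : N = M by apply: val_inj; rewrite /= [LHS]eqN eqM.
by have -> : N' = M' by apply: val_inj; rewrite /= [LHS]eqN' eqM'.
Qed.
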